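(* Let $P$ be a self-opposite parabolic subgroup of $G$, $H\subset G$ a closed subgroup with $P\backslash G/H$ finite, and $I\subset P\backslash G/H$ a fixed ideal. To a Zariski dense $P$-Anosov representation $\rho:\Gamma\to G$ associate the domain of discontinuity $\Omega^I_\rho\subset G/H$, assumed to be a complex curve, and the corresponding free abelian group $F^{ab}_\rho$. Then the free abelian group is well defined up to isomorphism on the character variety $\mathrm{Hom}^{zd}_P(\Gamma,G)/G$ of Zariski dense $P$-Anosov representations; that is, for every such $\rho$ and every $g\in G$, $F^{ab}_{g\rho g^{-1}}\cong F^{ab}_\rho$ as groups.
   Context: Setting. $\Gamma$ is a finitely generated word hyperbolic group with boundary $\partial_\infty\Gamma$; $G$ is a complex semisimple algebraic Lie group; $P=P^+$ is a parabolic subgroup that is self-opposite, i.e. conjugate to its opposite parabolic $P^-$, so $G/P^+$ and $G/P^-$ are canonically identified. $\partial_\infty\Gamma^{(2)}=\partial_\infty\Gamma\times\partial_\infty\Gamma\setminus\{(t,t)\}$. Two points of $G/P$ are transverse if the pair lies in the unique open $G$-orbit of $G/P^+\times G/P^-$. $\hat\Gamma$ is the (essentially unique) proper hyperbolic metric space with an action of $\Gamma\times(\mathbb{R}\rtimes\mathbb{Z}/2\mathbb{Z})$ such that $\Gamma\times\mathbb{Z}/2\mathbb{Z}$ acts isometrically, every orbit map $\Gamma\to\hat\Gamma$ is a quasi-isometry, the $\mathbb{R}$-action $\phi_t$ is free with quasi-isometrically embedded orbits, and the induced map $(\tau^+,\tau^-):\hat\Gamma/\mathbb{R}\to\partial_\infty\Gamma^{(2)}$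 is a homeomorphism. A representation $\rho:\Gamma\to G$ is $P$-Anosov if there is a continuous $\rho$-equivariant limit map $\xi_\rho:\partial_\infty\Gamma\to G/P$ such that (1) $\xi_\rho(t^+),\xi_\rho(t^-)$ are transverse for all $(t^+,t^-)\in\partial_\infty\Gamma^{(2)}$; (2) for one (hence any) continuous equivariant family of norms $\|\cdot\|_{\hat m}$, $\hat m\in\hat\Gamma$, on $T_{\xi_\rho(\tau^+(\hat m))}G/P$ (resp. $T_{\xi_\rho(\tau^-(\hat m))}G/P$) there are $A,a>0$ with $\|e\|_{\phi_{-t}(\hat m)}\le Ae^{-at}\|e\|_{\hat m}$ (resp. $\|e\|_{\phi_t(\hat m)}\le Ae^{-at}\|e\|_{\hat m}$) for all $t\ge0$, $\hat m$, $e$. $\mathrm{Hom}^{zd}_P(\Gamma,G)$ is the set of $P$-Anosov representations with Zariski dense image, on which $G$ acts by conjugation, $(g\rho g^{-1})(\gamma)=g\rho(\gamma)g^{-1}$. Domain $\Omega^I_\rho$. $\mathcal{X}=G/H$. For $(m,x)\in G/P\times\mathcal{X}$, $\mathrm{pos}(m,x)$ denotes its $G$-orbit under the diagonal action; via $\mathrm{pos}(g_1P,g_2H)\mapsto Pg_1^{-1}g_2H$ the set of orbits is identified with $P\backslash G/H$. The partial order is $PgH\le Pg'H$ iff $PgH\subset\overline{Pg'H}$; $I\subset P\backslash G/H$ is an ideal if $p\in I$, $p'\le p$ imply $p'\in I$. Then $$\Omega^I_\rho=\mathcal{X}\setminus\bigcup_{z\in\partial_\infty\Gamma}\{x\in\mathcal{X}:\mathrm{pos}(\xi_\rho(z),x)\in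 I\}.$$ The ideal $I$ is assumed such that $\Omega^I_\rho$ is a domain of discontinuity for the representations considered: an open $\rho(\Gamma)$-invariant subset such that $\{\gamma\in\Gamma:\rho(\gamma)K\cap K\ne\emptyset\}$ is finite for every compact $K\subset\Omega^I_\rho$. It is also assumed to be a complex curve ($\dim_{\mathbb{C}}=1$) on which $\rho(\Gamma)$ acts by biholomorphisms. The group $F^{ab}_\rho$. On $\rho(\Gamma)$ put $h\sim h'$ iff $h$ and $h'$ induce the same map of $\Omega^I_\rho$, and $\overline{\rho(\Gamma)}=\rho(\Gamma)/\sim$. For $h\in\rho(\Gamma)$, $\mathcal{E}^h_\rho=h^*T^{1,0}\Omega^I_\rho$ is the pullback of the $(1,0)$-part of the complexified tangent bundle; $\mathcal{E}^h_\rho=\mathcal{E}^{h'}_\rho$ as generators iff $h\sim h'$. $F^{ab}_\rho$ is the free abelian group on $\{\mathcal{E}^h_\rho\}_{[h]\in\overline{\rho(\Gamma)}}$, with (formal) tensor product as group law, identity the trivial line bundle $\mathcal{O}$, and inverses given by duals. *)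

(* Defs.v *)
From HB Require Import structures.
From mathcomp Require Import all_boot all_order all_algebra.
From mathcomp Require Import all_classical all_reals all_analysis.
From mathcomp Require Import complex.
From mathcomp.multinomials Require Import freeg.
From mathcomp.multinomials Require mpoly.

Set Implicit Arguments.
Unset Strict Implicit.
Unset Printing Implicit Defensive.

Import Order.TTheory GRing.Theory Num.Theory.
Import numFieldNormedType.Exports.
Local Open Scope classical_set_scope.
Local Open Scope ring_scope.

(* The head constant keeps the structure of R[i] as a numClosedFieldType
   visible, from which its topology is inferred. *)
Definition Cplx (R : realType) : numClosedFieldType := R[i].

Section Hyperbolic.
Context (R : realType) (T : Type) (d : T -> T -> R).

Definition gromov_product (o x y : T) : R := (d o x + d o y - d x y) / 2.

Definition gromov_hyperbolic : Prop :=
  exists delta : R, forall o x y z,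
    Num.min (gromov_product o x y) (gromov_product o y z) - delta
      <= gromov_product o x z.

(* (s_i | s'_j)_o tends to infinity as i, j do; for s' = s this says that s
   converges to a point at infinity. *)
Definition asymptotic (o : T) (s s' : nat -> T) : Prop :=
  forall M : R, \forall i \near \oo & j \near \oo,
    M <= gromov_product o (s i) (s' j).

Definition quasi_isometric_embedding (T' : Type) (d' : T' -> T' -> R)
    (f : T -> T') : Prop :=
  exists L c : R, 0 < L /\ forall x y,
    d x y / L - c <= d' (f x) (f y) <= L * d x y + c.

Definition quasi_isometry (T' : Type) (d' : T' -> T' -> R)
    (f : T -> T') : Prop :=
  quasi_isometric_embedding d' f /\
  exists c : R, forall y, exists x, d' (f x) y <= c.

End Hyperbolic.

Section WordMetric.
Context (R : realType) (Gam : groupType) (S : seq Gam).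

(* Words in the letters S and their inverses representing g. *)
Definition words (g : Gam) : set (seq Gam) :=
  [set w | all (fun s => (s \in S) || (s^-1%g \in S)) w /\
           foldr (fun a b => (a * b)%g) 1%g w = g].

Definition generates : Prop := forall g, words g !=set0.

Definition word_dist (x y : Gam) : R :=
  inf [set (size w)%:R | w in words (x^-1 * y)%g].

Definition boundary_points : set (set (nat -> Gam)) :=
  [set c | exists2 s, asymptotic word_dist 1%g s s &
     c = [set s' | asymptotic word_dist 1%g s' s' /\
                   asymptotic word_dist 1%g s s']].

Definition boundary : Type := set_type boundary_points.

HB.instance Definition _ := gen_eqMixin boundary.
HB.instance Definition _ := gen_choiceMixin boundary.

(* q belongs to the basic neighbourhood of radius r of p. *)
Definition boundary_close (p : boundary) (r : R) (q : boundary) : Prop :=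
  exists s s', [/\ val p s, val q s' &
    \forall i \near \oo & j \near \oo,
      r <= gromov_product word_dist 1%g (s i) (s' j)].

Definition boundary_open (U : set boundary) : Prop :=
  forall p, U p -> exists r, forall q, boundary_close p r q -> U q.

Lemma boundary_openT : boundary_open setT.
Proof. by move=> p _; exists 0. Qed.

Lemma boundary_openI : setI_closed boundary_open.
Proof.
move=> U V oU oV p [/oU[r Ur] /oV[r' Vr']].
exists (Num.max r r') => q [s [s' [ps qs' H]]].
have le_max (a : R) : a <= Num.max r r' -> boundary_close p a q.
  move=> le_a; exists s, s'; split=> //.
  by apply: filterS H => -[i j] /=; apply: le_trans.
by split; [apply: Ur | apply: Vr']; apply: le_max; rewrite le_max lexx ?orbT.
Qed.

Lemma boundary_open_bigU (I : Type) (f : I -> set boundary) :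
  (forall i, boundary_open (f i)) -> boundary_open (\bigcup_i f i).
Proof.
move=> of_ p [i _ fip]; have [r Hr] := of_ i p fip.
by exists r => q /Hr fiq; exists i.
Qed.

HB.instance Definition _ := isOpenTopological.Build boundary
  boundary_openT boundary_openI boundary_open_bigU.

(* z' = gam z for the natural action of Gam on its boundary *)
Definition boundary_act (gam : Gam) (z z' : boundary) : Prop :=
  exists2 s, val z s & val z' (fun k => (gam * s k)%g).

End WordMetric.

Section FlowSpace.
Context (R : realType) (Gam : groupType) (S : seq Gam) (X : metricType R).

Definition proper_metric : Prop :=
  forall (x : X) (r : R), compact [set y | mdist x y <= r].

(* Through the orbit map of m, the point z of the boundary of Gam is the limit
   of the flow line t |-> phi t m as t tends to F (F = +oo or -oo). *)
Definition flow_limit (act : Gam -> X -> X) (phi : R -> X -> X)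
    (F : set_system R) (m : X) (z : boundary R S) : Prop :=
  forall s, val z s -> forall M : R, \forall k \near \oo & t \near F,
    M <= gromov_product (@mdist R X) m (act (s k) m) (phi t m).

Record flow_space := FlowSpace {
  fs_act : Gam -> X -> X;
  fs_flow : R -> X -> X;
  fs_flip : X -> X;
  tau_p : X -> boundary R S;
  tau_m : X -> boundary R S;
  fs_proper : proper_metric;
  fs_hyperbolic : gromov_hyperbolic (@mdist R X);
  (* fs_act, fs_flow and fs_flip generate an action of Gam x (R x| Z/2) *)
  fs_act1 : forall m, fs_act 1%g m = m;
  fs_actM : forall a b m, fs_act (a * b)%g m = fs_act a (fs_act b m);
  fs_flow0 : forall m, fs_flow 0 m = m;
  fs_flowD : forall s t m, fs_flow (s + t) m = fs_flow s (fs_flow t m);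
  fs_flow_continuous : continuous (fun p : R * X => fs_flow p.1 p.2);
  fs_flipK : involutive fs_flip;
  fs_act_flow : forall a t m, fs_act a (fs_flow t m) = fs_flow t (fs_act a m);
  fs_act_flip : forall a m, fs_act a (fs_flip m) = fs_flip (fs_act a m);
  fs_flip_flow : forall t m, fs_flip (fs_flow t m) = fs_flow (- t) (fs_flip m);
  fs_act_isom : forall a m m', mdist (fs_act a m) (fs_act a m') = mdist m m';
  fs_flip_isom : forall m m', mdist (fs_flip m) (fs_flip m') = mdist m m';
  fs_orbit_qi : forall m,
    quasi_isometry (@word_dist R Gam S) (@mdist R X) (fun a => fs_act a m);
  fs_flow_free : forall t m, fs_flow t m = m -> t = 0;
  fs_flow_qi : forall m, quasi_isometric_embedding (fun s t : R => `|s - t|)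
    (@mdist R X) (fun t => fs_flow t m);
  (* The map induced on X / R by (tau_p, tau_m) is a homeomorphism onto the
     pairs of distinct points; as X -> X / R is open, its openness can be
     stated on X. *)
  tau_p_limit : forall m, flow_limit fs_act fs_flow +oo m (tau_p m);
  tau_m_limit : forall m, flow_limit fs_act fs_flow -oo m (tau_m m);
  tau_flow : forall t m,
    tau_p (fs_flow t m) = tau_p m /\ tau_m (fs_flow t m) = tau_m m;
  tau_inj : forall m m', tau_p m = tau_p m' -> tau_m m = tau_m m' ->
    exists t, m' = fs_flow t m;
  tau_neq : forall m, tau_p m <> tau_m m;
  tau_surj : forall z z', z <> z' -> exists m, tau_p m = z /\ tau_m m = z';
  tau_continuous : continuous (fun m => (tau_p m, tau_m m));
  tau_open : forall U : set X, open U ->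
    exists2 O : set (boundary R S * boundary R S), open O &
      [set (tau_p m, tau_m m) | m in U] = O `&` [set z | z.1 <> z.2]
}.

End FlowSpace.

Section AlgebraicGroup.
(* mx is a closed embedding of G into GL_n(C), see linear_algebraic. *)
Context (R : realType) (G : groupType) (n : nat) (mx : G -> 'M[Cplx R]_n).

Definition poly_at (p : mpoly.mpoly (n * n) (Cplx R)) (M : 'M[Cplx R]_n) :
  Cplx R := mpoly.meval (mxvec M 0) p.

Definition linear_algebraic : Prop :=
  [/\ forall a b, mx (a * b)%g = mx a *m mx b, mx 1%g = 1%:M, injective mx &
   exists E : set (mpoly.mpoly (n * n) (Cplx R)),
     range mx = [set M | M \in unitmx /\ forall p, E p -> poly_at p M = 0]].

(* Polynomials in the entries suffice, since det is invertible on GL_n. *)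
Definition zariski_closed (A : set G) : Prop :=
  exists E : set (mpoly.mpoly (n * n) (Cplx R)),
    A = [set a | forall p, E p -> poly_at p (mx a) = 0].

Definition zariski_dense (A : set G) : Prop :=
  forall B, zariski_closed B -> A `<=` B -> B = setT.

Definition zariski_connected (A : set G) : Prop :=
  forall B B', zariski_closed B -> zariski_closed B' ->
    A = B `|` B' -> B `&` B' = set0 -> B = set0 \/ B' = set0.

Definition subgroup (A : set G) : Prop :=
  [/\ A 1%g, forall a b, A a -> A b -> A (a * b)%g &
      forall a, A a -> A (a^-1)%g].

Definition algebraic_subgroup (A : set G) : Prop :=
  subgroup A /\ zariski_closed A.

Definition normal_in (A B : set G) : Prop :=
  B `<=` A /\ forall a b, A a -> B b -> B (a * b * a^-1)%g.

Definition commutators (A : set G) : set G :=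
  [set x | exists a b, [/\ A a, A b & x = (a^-1 * b^-1 * a * b)%g]].

Definition derived_subgroup (A : set G) : set G :=
  \bigcap_(B in [set B | subgroup B /\ commutators A `<=` B]) B.

Definition solvable_subgroup (A : set G) : Prop :=
  exists k, iter k derived_subgroup A `<=` [set 1%g].

Definition unipotent_subgroup (A : set G) : Prop :=
  forall a, A a -> (mx a - 1%:M) ^+ n = 0.

Definition semisimple : Prop :=
  zariski_connected setT /\
  forall A, algebraic_subgroup A -> normal_in setT A -> zariski_connected A ->
    solvable_subgroup A -> A = [set 1%g].

Definition solvable_connected (A : set G) : Prop :=
  [/\ algebraic_subgroup A, zariski_connected A & solvable_subgroup A].

Definition borel (B : set G) : Prop :=
  solvable_connected B /\
  forall B', solvable_connected B' -> B `<=` B' -> B' = B.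

Definition parabolic (P : set G) : Prop :=
  algebraic_subgroup P /\ exists2 B, borel B & B `<=` P.

Definition connected_normal_unipotent (P U : set G) : Prop :=
  [/\ algebraic_subgroup U, normal_in P U, zariski_connected U &
      unipotent_subgroup U].

Definition unipotent_radical (P U : set G) : Prop :=
  connected_normal_unipotent P U /\
  forall U', connected_normal_unipotent P U' -> U' `<=` U.

Definition levi (P L : set G) : Prop :=
  [/\ algebraic_subgroup L, L `<=` P & exists2 U, unipotent_radical P U &
      L `&` U = [set 1%g] /\
      P = [set x | exists l u, [/\ L l, U u & x = (l * u)%g]]].

Definition opposite (P Q : set G) : Prop :=
  [/\ parabolic P, parabolic Q, levi P (P `&` Q) & levi Q (P `&` Q)].

Definition self_opposite (P : set G) : Prop :=
  exists w : G, opposite P [set (w * a * w^-1)%g | a in P].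

(* Zariski tangent space at the identity *)
Definition lie (A : set G) : set 'M[Cplx R]_n :=
  [set X | forall p, (forall a, A a -> poly_at p (mx a) = 0) ->
     \sum_k poly_at (mpoly.mderiv k p) 1%:M * mxvec X 0 k = 0].

(* The complex Lie group topology, as opposed to the Zariski topology. *)
Definition lie_group : Type := initial_topology mx.
HB.instance Definition _ := Topological.on lie_group.

Section Coset.
Context (H : set G).

Definition lcoset (a : G) : set G := [set (a * h)%g | h in H].

(* The set of left cosets does not depend on the embedding of G, but its
   topology does. *)
Definition cosets_wrt (_ : G -> 'M[Cplx R]_n) : Type := set_type (range lcoset).
Definition coset_space : Type := cosets_wrt mx.

HB.instance Definition _ := gen_eqMixin coset_space.
HB.instance Definition _ := gen_choiceMixin coset_space.

Lemma lcosetP (a : G) : lcoset a \in range lcoset.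
Proof. by apply/mem_set; exists a. Qed.

Definition coset_of (a : G) : coset_space := exist _ (lcoset a) (lcosetP a).

Lemma translateP (a : G) (x : coset_space) :
  [set (a * b)%g | b in val x] \in range lcoset.
Proof.
apply/mem_set; case: x => c /= /set_mem[b _ <-]; exists (a * b)%g => //.
apply/seteqP; split=> y /=.
  by case=> h Hh <-; exists (b * h)%g; [exists h | rewrite mulgA].
by case=> _ [h Hh <-] <-; exists h; rewrite ?mulgA.
Qed.

Definition translate (a : G) (x : coset_space) : coset_space :=
  exist _ [set (a * b)%g | b in val x] (translateP a x).

Definition coset_open (U : set coset_space) : Prop :=
  open (coset_of @^-1` U : set lie_group).

Lemma coset_openT : coset_open setT.
Proof. exact: openT. Qed.

Lemma coset_openI : setI_closed coset_open.
Proof. by move=> U V; rewrite /coset_open preimage_setI; exact: openI. Qed.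

Lemma coset_open_bigU (I : Type) (f : I -> set coset_space) :
  (forall i, coset_open (f i)) -> coset_open (\bigcup_i f i).
Proof.
move=> of_; rewrite /coset_open preimage_bigcup.
by apply: bigcup_open => i _; exact: of_.
Qed.

HB.instance Definition _ := isOpenTopological.Build coset_space
  coset_openT coset_openI coset_open_bigU.

Definition stabiliser (x : coset_space) : set G := [set a | translate a x = x].

End Coset.

(* Both G/P^+ and G/P^- are identified with G/P (P is self-opposite), so the
   open G-orbit is considered in G/P x G/P. *)
Definition transverse (P : set G) (x y : coset_space P) : Prop :=
  open [set (translate a x, translate a y) | a in [set: G]].

Definition dcoset (P H : set G) (a : G) : set G :=
  [set x | exists p h, [/\ P p, H h & x = (p * a * h)%g]].

Definition dcosets (P H : set G) : set (set G) := range (dcoset P H).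

(* pos (aP, bH) = P a^-1 b H *)
Definition pos (P H : set G) (m : coset_space P) (x : coset_space H) : set G :=
  [set y | exists a b, [/\ val m a, val x b & y = (a^-1 * b)%g]].

Definition dcoset_le (D D' : set G) : Prop :=
  D `<=` closure (D' : set lie_group).

Definition ideal (P H : set G) (I : set (set G)) : Prop :=
  I `<=` dcosets P H /\
  forall D D', I D -> dcosets P H D' -> dcoset_le D' D -> I D'.

End AlgebraicGroup.

Section Anosov.
Context (R : realType) (Gam : groupType) (S : seq Gam) (X : metricType R)
  (fs : flow_space S X).
Context (G : groupType) (n : nat) (mx : G -> 'M[Cplx R]_n) (P : set G).

Definition representation (rho : Gam -> G) : Prop :=
  forall a b, rho (a * b)%g = (rho a * rho b)%g.

Definition conj_rep (g : G) (rho : Gam -> G) : Gam -> G :=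
  fun a => (g * rho a * g^-1)%g.

(* A continuous equivariant family of norms on the spaces T_{xi (tau m)} G/P.
   The tangent space T_x G/P is lie G / lie (stabiliser x), so a norm on it is
   a seminorm on lie G with kernel lie (stabiliser x); the derivative
   T_x -> T_{a x} of a is then induced by Ad a. *)
Definition norm_family (rho : Gam -> G) (xi : boundary R S -> coset_space mx P)
    (tau : X -> boundary R S) (N : X -> 'M[Cplx R]_n -> R) : Prop :=
  let g := lie mx setT in
  [/\ forall m v, g v ->
        0 <= N m v /\ (N m v = 0 <-> lie mx (stabiliser (xi (tau m))) v),
      forall m v w, g v -> g w -> N m (v + w) <= N m v + N m w,
      forall m (r : R) v, g v ->
        N m ((real_complex R r : Cplx R) *: v) = `|r| * N m v,
      {within [set p | g p.2],
        continuous (fun p : X * 'M[Cplx R]_n => N p.1 p.2)} &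
      forall a m v, g v ->
        N (fs_act fs a m) (mx (rho a) *m v *m mx (rho a)^-1%g) = N m v].

Definition contracting (rho : Gam -> G) (xi : boundary R S -> coset_space mx P)
    (tau : X -> boundary R S) (flow : R -> X -> X) : Prop :=
  exists2 N, norm_family rho xi tau N &
  exists A a : R, [/\ 0 < A, 0 < a & forall t m v, 0 <= t -> lie mx setT v ->
    N (flow t m) v <= A * expR (- a * t) * N m v].

Definition is_limit_map (rho : Gam -> G)
    (xi : boundary R S -> coset_space mx P) : Prop :=
  [/\ continuous xi,
      forall a z z', boundary_act a z z' -> xi z' = translate (rho a) (xi z),
      forall z z', z <> z' -> transverse (xi z) (xi z'),
      contracting rho xi (tau_p fs) (fun t => fs_flow fs (- t)) &
      contracting rho xi (tau_m fs) (fs_flow fs)].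

Definition anosov (rho : Gam -> G) : Prop :=
  representation rho /\ exists xi, is_limit_map rho xi.

Definition hom_zd : set (Gam -> G) :=
  [set rho | anosov rho /\ zariski_dense mx (range rho)].

(* The limit map of an Anosov representation is unique, so that the choice made
   by xget is immaterial. *)
Definition limit_map (rho : Gam -> G) : boundary R S -> coset_space mx P :=
  xget (fun=> coset_of mx P 1%g) [set xi | is_limit_map rho xi].

Section Domain.
Context (H : set G) (I : set (set G)).
Local Notation GH := (coset_space mx H).

Definition Omega (rho : Gam -> G) : set GH :=
  ~` \bigcup_z [set x | I (pos (limit_map rho z) x)].

Definition domain_of_discontinuity (rho : Gam -> G) (W : set GH) : Prop :=
  [/\ open W,
      forall a x, W x -> W (translate (rho a) x) &
      forall K : set GH, compact K -> K `<=` W ->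
        finite_set [set a | (translate (rho a) @` K) `&` K !=set0]].

End Domain.
End Anosov.

Section Curve.
Context (R : realType) (T : topologicalType).

Record chart := Chart { chart_dom : set T; chart_map : T -> Cplx R }.

(* The expression of f in the chart c, near c x. *)
Definition in_chart (c : chart) (x : T) (f : T -> Cplx R) : Cplx R -> Cplx R :=
  f \o 'pinv_(fun=> x) (chart_dom c) (chart_map c).

Definition chart_on (W : set T) (c : chart) : Prop :=
  [/\ open (chart_dom c) /\ chart_dom c `<=` W,
      {in chart_dom c &, injective (chart_map c)},
      {within chart_dom c, continuous (chart_map c)} &
      forall U, open U -> U `<=` chart_dom c -> open (chart_map c @` U)].

Definition holomorphic_wrt (J : set chart) (W : set T) (h : T -> T) : Prop :=
  forall c c' x, J c -> J c' -> W x -> chart_dom c x -> chart_dom c' (h x) ->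
    derivable (in_chart c x (chart_map c' \o h)) (chart_map c x) 1.

(* J is a holomorphic atlas of W; a curve, having dimension 1, is not empty. *)
Definition complex_curve (J : set chart) (W : set T) : Prop :=
  [/\ W !=set0, forall c, J c -> chart_on W c,
      forall x, W x -> exists2 c, J c & chart_dom c x &
      holomorphic_wrt J W id].

(* A real tangent vector at x is given by its coordinates in the charts at x,
   and is set to 0 in the other ones. *)
Definition tangent (J : set chart) (x : T) : set (chart -> Cplx R) :=
  [set v | (forall c, ~ (J c /\ chart_dom c x) -> v c = 0) /\
    forall c c', J c -> J c' -> chart_dom c x -> chart_dom c' x ->
      v c' = 'D_1 (in_chart c x (chart_map c')) (chart_map c x) * v c].

(* The total space of the bundle T^{1,0}: (x, (u, w)) stands for the vector
   u + i w of the complexification of the tangent space at x, and the complex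
   structure (u |-> 'i * u in the charts), extended linearly, has to act on it
   as the multiplication by i. *)
Definition T10 (J : set chart) (W : set T) :
    set (T * ((chart -> Cplx R) * (chart -> Cplx R))) :=
  [set e | [/\ W e.1, tangent J e.1 e.2.1, tangent J e.1 e.2.2 &
    forall c, 'i * e.2.1 c = - e.2.2 c /\ 'i * e.2.2 c = e.2.1 c]].

(* The total space of h^* T^{1,0}W *)
Definition pullback_T10 (J : set chart) (W : set T) (h : T -> T) :
    set (T * (T * ((chart -> Cplx R) * (chart -> Cplx R)))) :=
  [set xe | [/\ W xe.1, T10 J W xe.2 & h xe.1 = xe.2.1]].

End Curve.

Section FreeAbelian.
Context (R : realType) (Gam : groupType) (S : seq Gam) (X : metricType R)
  (fs : flow_space S X).
Context (G : groupType) (n : nat) (mx : G -> 'M[Cplx R]_n) (P H : set G)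
  (I : set (set G)).
Local Notation GH := (coset_space mx H).

(* rho(Gam) is a group, so the inverses of the holomorphic maps below are also
   holomorphic. *)
Definition curve_domain (rho : Gam -> G) (J : set (chart R GH)) : Prop :=
  let W := Omega fs P I rho in
  [/\ domain_of_discontinuity rho W, complex_curve J W &
      forall a, holomorphic_wrt J W (translate (rho a))].

(* E^h = h^* T^{1,0} Omega, h in rho(Gam). As sets, E^h = E^h' if and only if
   h and h' induce the same map of Omega. *)
Definition generators (rho : Gam -> G) (J : set (chart R GH)) :=
  [set pullback_T10 J (Omega fs P I rho) (translate h) | h in range rho].

(* The law of F^ab, a formal tensor product, is written additively. *)
Definition Fab (rho : Gam -> G) (J : set (chart R GH)) : zmodType :=
  {freeg {classic set_type (generators rho J)} / int}.

End FreeAbelian.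

Definition isomorphic (A B : zmodType) : Prop :=
  exists f : {additive A -> B}, bijective f.

(* Main.v *)
(* F^ab is determined up to isomorphism by the cardinality of its set of
   generators, so no comparison of the domains of rho and of its conjugate, and
   hence of their limit maps, is needed. If Gamma is infinite, proper
   discontinuity at a point x of Omega makes the stabiliser of x in Gamma finite,
   so a |-> E^{rho(a)} has finite fibres; as Gamma is countable, both sets of
   generators are countably infinite. If Gamma is finite, the Zariski dense image
   of rho is finite, hence is all of G, and G is trivial by connectedness. *)
From HB Require Import structures.
Require Import Defs.
From mathcomp Require Import all_boot all_order all_algebra.
From mathcomp Require Import all_classical all_reals all_analysis.
From mathcomp.multinomials Require Import freeg.
From mathcomp.multinomials Require Import -(notations) mpoly.

Set Implicit Arguments.
Unset Strict Implicit.
Unset Printing Implicit Defensive.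

Import Order.TTheory GRing.Theory Num.Theory.
Local Open Scope classical_set_scope.
Local Open Scope card_scope.
Local Open Scope ring_scope.

Section FreegMap.
Context (K L : choiceType) (f : K -> L).

Definition freeg_map : {freeg K / int} -> {freeg L / int} :=
  fglift (fun k => << f k >>).

HB.instance Definition _ :=
  GRing.isZmodMorphism.Build {freeg K / int} {freeg L / int} freeg_map
    (lift_is_additive (fun k => << f k >>)).

Lemma freeg_mapU (z : int) (k : K) : freeg_map << z *g k >> = << z *g f k >>.
Proof.
rewrite /freeg_map liftU; apply/eqP/freeg_eqP => l.
by rewrite coeffZ !coeffU mul1r.
Qed.

End FreegMap.

(** An additive map is determined by its values on multiples of generators, and [freeg_sumE] splits
    [D] into such multiples. *)
Lemma freeg_mapK (K L : choiceType) (f : K -> L) (f' : L -> K) :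
  cancel f f' -> cancel (freeg_map f) (freeg_map f').
Proof.
move=> fK D; rewrite -[D in RHS]freeg_sumE -[D in LHS]freeg_sumE.
by rewrite !raddf_sum; apply: eq_bigr => k _; rewrite /= !freeg_mapU fK.
Qed.

(** By functoriality, mutually inverse bijections of the bases induce mutually inverse
    homomorphisms. *)
Lemma freeg_isomorphic (T U : Type) (A : set T) (B : set U) : A #= B ->
  isomorphic {freeg {classic set_type A} / int}
             {freeg {classic set_type B} / int}.
Proof.
case/card_bijP=> f [f' fK f'K].
exists (freeg_map (f : {classic set_type A} -> {classic set_type B})).
by exists (freeg_map (f' : {classic set_type B} -> {classic set_type A}));
  apply: freeg_mapK.
Qed.

Lemma countable_generated (Gam : groupType) (S : seq Gam) :
  generates S -> countable [set: Gam].
Proof.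
(* A word in [S] and inverses is a product of letters of [L]; recording each letter by its index in
   [L] exhibits the group as an image of the countable type [seq nat]. *)
move=> genS; pose L := S ++ [seq (s^-1)%g | s <- S].
pose ev (w : seq nat) := foldr (fun i b => (nth 1%g L i * b)%g) 1%g w.
suff -> : [set: Gam] = range ev.
  exact: sub_countable (card_image_le _ _) (countableP _).
apply/seteqP; split=> // g _; have [w [wS <-]] := genS g.
exists [seq index s L | s <- w] => //.
elim: w wS {g} => //= s w IHw /andP[sS /IHw ->]; rewrite nth_index // mem_cat.
case/orP: sS => [->//|s'S]; apply/orP; right.
by rewrite -[s]invgK map_f.
Qed.

Section Zariski.
Context (R : realType) (G : groupType) (n : nat) (mx : G -> 'M[Cplx R]_n).

(** A point [b] outside the finite set differs from each of its points [a] in some matrix entry [k],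
    as [mx] is injective. The product over [a] of the polynomials [sep a k] vanishes on the set but
    not at [b]. *)
Lemma finite_zariski_closed (A : set G) :
  injective mx -> finite_set A -> zariski_closed mx A.
Proof.
move=> mx_inj /finite_seqP[s ->].
exists [set p | forall a, a \in s -> poly_at p (mx a) = 0].
apply/seteqP; split=> [a /= sa p|b /= Hb]; first exact.
apply/negP => /negP bs.
pose sep a k : mpoly (n * n) (Cplx R) :=
  mpolyX (Cplx R) (mnm1 k) - mpolyC (n * n) (mxvec (mx a) 0 k).
have sepE a k c :
    poly_at (sep a k) (mx c) = mxvec (mx c) 0 k - mxvec (mx a) 0 k.
  by rewrite /poly_at mevalB mevalXU mevalC.
have sepP a : a \in s -> exists k, poly_at (sep a k) (mx b) != 0.
  move=> sa; apply: contrapT => /forallNP eq_ab.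
  case/negP: bs; suff -> : b = a by [].
  apply: mx_inj; apply: (can_inj mxvecK); apply/rowP => k.
  by apply/eqP; rewrite -subr_eq0 -sepE; apply/negPn/negP.
have {}sepP : exists p,
    (forall a, a \in s -> poly_at p (mx a) = 0) /\ poly_at p (mx b) != 0.
  elim: s sepP {Hb bs} => [_|a s IHs sepP].
    by exists 1; split=> //; rewrite /poly_at meval1 oner_neq0.
  have [c sc|p [ps pb]] := IHs; first by apply: sepP; rewrite inE sc orbT.
  have [k kb] := sepP a (mem_head _ _); exists (sep a k * p).
  split=> [c|]; rewrite /poly_at mevalM; last exact: mulf_neq0.
  rewrite inE => /orP[/eqP->|/ps pc]; last by rewrite [X in _ * X]pc mulr0.
  by rewrite [X in X * _]sepE subrr mul0r.
by have [p [ps]] := sepP; rewrite Hb ?eqxx.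
Qed.

Lemma finite_zariski_dense (A : set G) :
  injective mx -> zariski_connected mx setT -> finite_set A ->
  zariski_dense mx A -> forall a : G, a = 1%g.
Proof.
move=> mx_inj connG finA denseA a.
have AT : A = setT by apply: denseA => //; apply: finite_zariski_closed.
(* [G] being finite, all its subsets are closed, so connectedness forces [{1}] or its complement to
   be empty. *)
have closed B : zariski_closed mx B.
  by apply: finite_zariski_closed => //; apply: sub_finite_set finA; rewrite AT.
have [| |/seteqP[H1 _]|/seteqP[H1 _]] :=
  connG [set 1%g] (~` [set 1%g]) (closed _) (closed _).
- by rewrite setUv.
- by rewrite setICr.
- by case: (H1 1%g).
- by apply: contrapT => /H1.
Qed.

End Zariski.

Section Action.
Context (R : realType) (G : groupType) (n : nat) (mx : G -> 'M[Cplx R]_n)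
  (H : set G).
Implicit Type x : coset_space mx H.

Lemma translate1 x : translate 1%g x = x.
Proof.
apply: val_inj; rewrite /= -[RHS]image_id; apply: eq_imagel => b _ /=.
exact: mul1g.
Qed.

Lemma translateM (a b : G) x :
  translate (a * b)%g x = translate a (translate b x).
Proof.
apply: val_inj; rewrite /= image_comp; apply: eq_imagel => c _ /=.
exact/esym/mulgA.
Qed.

End Action.

Section Representation.
Context (Gam G : groupType) (rho : Gam -> G).
Hypothesis rhoM : representation rho.

Lemma representation1 : rho 1%g = 1%g.
Proof. by apply: (mulgI (rho 1%g)); rewrite -rhoM !mulg1. Qed.

Lemma representation_conj g : representation (conj_rep g rho).
Proof. by move=> a b; rewrite /conj_rep rhoM !mulgA mulgVK. Qed.

End Representation.

Section Generators.
Context (R : realType) (Gam : groupType) (S : seq Gam) (X : metricType R)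
  (fs : flow_space S X).
Context (G : groupType) (n : nat) (mx : G -> 'M[Cplx R]_n) (P H : set G)
  (I : set (set G)).

(* The zero section of h^* T^{1,0} W is the graph of h on W. *)
Lemma pullback_T10_inj (T : topologicalType) (J : set (chart R T)) (W : set T)
    (h h' : T -> T) x :
  W x -> W (h x) -> pullback_T10 J W h = pullback_T10 J W h' -> h' x = h x.
Proof.
move=> Wx Whx /seteqP[/(_ (x, (h x, (fun=> 0, fun=> 0)))) hh' _].
have tangent0 : tangent J (h x) (fun=> 0).
  by split=> // c c' *; rewrite mulr0.
by case: hh' => //; split=> //; split=> //= c; rewrite mulr0 ?oppr0.
Qed.

Lemma infinite_generators (rho : Gam -> G)
    (J : set (chart R (coset_space mx H))) :
  infinite_set [set: Gam] -> representation rho -> curve_domain fs P I rho J ->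
  infinite_set (generators fs P I rho J).
Proof.
move=> infGam rhoM [[oW rhoW proper] [[x Wx] _ _ _] _] fin; apply: infGam.
set W := Omega _ _ _ _ in oW rhoW proper Wx fin.
pose E a := pullback_T10 J W (translate (rho a)).
(* Proper discontinuity is applied to the compact set [{x}]. *)
have finStab : finite_set [set a | translate (rho a) x = x].
  have := proper [set x] (@compact_set1 _ x).
  have sub : [set x] `<=` W by move=> _ ->.
  move=> /(_ sub); apply: sub_finite_set => a /= ax.
  by exists x; split=> //; exists x.
(* [Gam] is the union of the fibres of [E], finitely many by [fin]; it remains to see that each
   fibre is finite. *)
have -> : [set: Gam] =
    \bigcup_(e in generators fs P I rho J) (E @^-1` [set e]).
  by apply/seteqP; split=> // a _; exists (E a) => //; exists (rho a).
apply: bigcup_finite => // _ [_ [b _ <-] <-].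
(* The fibre through [b] lies in the left coset of the stabiliser by [b]: if [E a = E b], then
   [rho a] and [rho b] agree at [x], so [b^-1 * a] fixes [x]. *)
apply: sub_finite_set (finite_image (fun c => b * c)%g finStab) => a /= Eab.
exists (b^-1 * a)%g; last by rewrite mulVKg.
rewrite rhoM translateM (pullback_T10_inj Wx (rhoW b x Wx) (esym Eab)).
by rewrite -translateM -rhoM mulVg representation1 // translate1.
Qed.

End Generators.

Theorem theorem6p1 (R : realType)
  (Gam : groupType) (S : seq Gam) (HS : generates S)
  (Hhyp : gromov_hyperbolic (@word_dist R Gam S))
  (X : metricType R) (fs : flow_space S X)
  (G : groupType) (n : nat) (mx : G -> 'M[Cplx R]_n)
  (HG : linear_algebraic mx) (Hss : semisimple mx)
  (P : set G) (HP : self_opposite mx P)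
  (H : set G) (HH : subgroup H) (HHc : closed (H : set (lie_group mx)))
  (Hfin : finite_set (dcosets P H))
  (I : set (set G)) (HI : ideal mx P H I)
  (rho : Gam -> G) (Hrho : hom_zd fs mx P rho) (g : G)
  (J Jg : set (chart R (coset_space mx H)))
  (HJ : curve_domain fs P I rho J)
  (HJg : curve_domain fs P I (conj_rep g rho) Jg) :
  isomorphic (Fab fs P I (conj_rep g rho) Jg) (Fab fs P I rho J).
Proof.
apply: freeg_isomorphic.
have [[rhoM _] denseG] := Hrho; have [_ _ mx_inj _] := HG.
have [finGam|infGam] := pselect (finite_set [set: Gam]).
  have G1 : forall a : G, a = 1%g.
    exact: finite_zariski_dense mx_inj Hss.1 (finite_image rho finGam) denseG.
  have range1 (sigma : Gam -> G) : range sigma = [set 1%g].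
    by apply/seteqP; split=> [a _|_ ->]; [exact: G1 | exists 1%g; rewrite ?G1].
  (* Each set of generators is now the image of a singleton, hence has one element whatever the
     domain and the atlas. *)
  rewrite /generators !range1 !image_set1.
  exact: eq_card1.
have generatorsN sigma (K : set (chart R (coset_space mx H))) :
    representation sigma -> curve_domain fs P I sigma K ->
    generators fs P I sigma K #= [set: nat].
  (* Countability holds because the generators form an image of [Gam] under a composite map. *)
  move=> sigmaM sigmaJ; apply: eq_card_nat; last exact: infinite_generators.
  rewrite /generators image_comp.
  exact: sub_countable (card_image_le _ _) (countable_generated HS).
rewrite (card_eql (generatorsN _ _ (representation_conj rhoM g) HJg)).
by apply: card_esym; apply: generatorsN.
Qed.
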